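(* Let $b\ge2$ be an integer, $\mathcal A=\{b^n:n\ge1\}$, and let $\psi:\mathbb N\to\mathbb R^+$ be non-increasing with $\sum_{n=1}^\infty b^{2n}\psi(b^n)<\infty$. Then for every $s\in(0,1)$, $$\mathcal H^s(\mathrm{Exact}_{\mathbb Z,\mathcal A}(\psi))=\begin{cases}0&\text{if }\sum_{n=1}^\infty b^n\psi(b^n)^s<\infty,\\ \infty&\text{if }\sum_{n=1}^\infty b^n\psi(b^n)^s=\infty.\end{cases}$$
   Context: $W_{\mathbb Z,\mathcal A}(1,\psi)=\{x\in[0,1]: |x-p/q|<\psi(q)\text{ for infinitely many }(p,q)\in\mathbb Z\times\mathcal A\}$ and $\mathrm{Exact}_{\mathbb Z,\mathcal A}(\psi)=W_{\mathbb Z,\mathcal A}(1,\psi)\setminus\bigcup_{0<\epsilon<1}W_{\mathbb Z,\mathcal A}(1,\epsilon\psi)$. $\mathcal H^s$ is the $s$-dimensional Hausdorff measure. *)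

(* Defs.v *)
From HB Require Import structures.
From mathcomp Require Import all_boot all_order all_algebra.
From mathcomp Require Import all_classical all_reals all_analysis.

Set Implicit Arguments.
Unset Strict Implicit.
Unset Printing Implicit Defensive.

Import Order.TTheory GRing.Theory Num.Theory.
Import numFieldNormedType.Exports.

Local Open Scope classical_set_scope.
Local Open Scope ring_scope.

(* [diam set0 = -oo]; the empty set is treated separately in [diam_pow]. *)
Definition diam (R : realType) (U : set R) : \bar R :=
  ereal_sup [set `|xy.1 - xy.2|%:E | xy in U `*` U].

Definition diam_pow (R : realType) (s : R) (U : set R) : \bar R :=
  if U == set0 then 0%E else (diam U `^ s)%E.

Definition hausdorff_content (R : realType) (s delta : R) (E : set R) :
    \bar R :=
  ereal_inf [set (\sum_(0 <= i <oo) diam_pow s (U i))%E |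
    U in [set U : nat -> set R |
      (forall i, (diam (U i) <= delta%:E)%E) /\ E `<=` \bigcup_i U i]].

(* The limit as [delta] tends to 0 is a supremum, since [hausdorff_content] is
   non-increasing in [delta]. *)
Definition hausdorff_measure (R : realType) (s : R) (E : set R) : \bar R :=
  ereal_sup [set hausdorff_content s delta E | delta in [set d : R | 0 < d]].

(* Infinitely many pairs [(p, q)]: fractions need not be in lowest terms. *)
Definition approx_set (R : realType) (A : set nat) (psi : nat -> R) : set R :=
  [set x | 0 <= x <= 1 /\
    infinite_set [set pq : int * nat |
      A pq.2 /\ `|x - pq.1%:~R / pq.2%:R| < psi pq.2]].

Definition exact_set (R : realType) (A : set nat) (psi : nat -> R) : set R :=
  approx_set A psi `\`
  \bigcup_(e in [set e : R | 0 < e < 1]) approx_set A (fun q => e * psi q).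

Definition powers (b : nat) : set nat :=
  [set q | exists2 n : nat, (1 <= n)%N & q = (b ^ n)%N].

(* Main.v *)
(* Convergence is a covering argument.  For divergence no measure is built: to
   bound the s-dimensional content of the exact set from below we produce, for
   any cheap family of sets U_i of diameter at most r_i, an exact point lying in
   none of them.  The point is the intersection of nested intervals
   c + [(1 - 2e) psi(b^n), (1 - e) psi(b^n)], c = p/b^n, with e -> 0.  Passing
   from one interval to the next, the candidates are centred at fractions
   (bq + 1)/b^m of many levels m, weighted by psi(b^m)^s.  A candidate is kept if
   its centre is far from all balls of intermediate levels; this guarantees
   exactness, and also makes candidates of different levels so well separated
   that a set of diameter r meets at most one candidate of the levels with
   r <= b^-m / 4.  As the total weight of the candidates can be made arbitrarily
   large by the divergence of the series, the weighted mean over the candidates J of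
   sum_{i : U_i meets J} min(1, 48 b (r_i / |J|)^s)
   is no larger than the same sum for the parent interval, so some candidate keeps
   this sum below 1.  Hence no U_i with r_i >= |J| ever meets J, and the limit
   point avoids every U_i. *)
Require Import Defs.
From mathcomp Require Import all_boot all_order all_algebra.
From mathcomp Require Import all_classical all_reals all_analysis.
From mathcomp Require Import ring lra zify.

Set Implicit Arguments.
Unset Strict Implicit.
Unset Printing Implicit Defensive.

Import Order.TTheory GRing.Theory Num.Theory.
Import numFieldNormedType.Exports.

Local Open Scope classical_set_scope.
Local Open Scope ring_scope.

(** * Counting naturals in an interval of given width *)

Section Counting.
Variables (R : realType) (K : nat).
Implicit Types (P : pred 'I_K) (a d : R).

(** Counted from its least element, [P] fits into a window of floor(d) + 1 consecutive naturals. *)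
Lemma card_ord_le_width P d : 0 <= d ->
  (forall i j, P i -> P j -> (j%:R - i%:R : R) <= d) ->
  #|P|%:R <= d + 1.
Proof.
move=> d0 dP; have [i0 Pi0|P0] := pickP P; last first.
  by rewrite (eq_card0 P0); lra.
have [i Pi imin] := arg_minnP (fun i : 'I_K => i : nat) Pi0.
have sub : {subset map val (enum P) <= iota i (Num.truncn d).+1}.
  move=> _ /mapP[j /[!mem_enum] Pj ->]; rewrite mem_iota imin//=.
  have := dP _ _ Pi Pj; rewrite -natrB ?imin// => H.
  rewrite addnS ltnS -leq_subLR truncn_ge_nat//.
have := uniq_leq_size _ sub; rewrite map_inj_uniq ?enum_uniq; last exact: val_inj.
rewrite size_map -cardE size_iota => /(_ isT) le.
apply: (@le_trans _ _ (Num.truncn d).+1%:R); first by rewrite ler_nat.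
by rewrite -[_.+1]addn1 natrD lerD2r truncn_le.
Qed.

Lemma card_ord_ge_width a d : 0 <= a -> a + d < K%:R ->
  d - 1 <= #|[pred i : 'I_K | a <= (i : nat)%:R <= a + d]|%:R.
Proof.
move=> a0 adK; set P := [pred i | _].
have [d1|d1] := leP d 1; first by apply: (@le_trans _ _ 0); [lra|rewrite ler0n].
set k := (Num.truncn a).+1; set D := Num.truncn (d - 1).
have kge : a < k%:R by rewrite -truncn_le_nat.
have kle : k%:R <= a + 1 by rewrite -[k]addn1 natrD lerD2r truncn_le.
have /andP[Dle Dlt] : D%:R <= d - 1 < D.+1%:R by apply: truncn_itv; lra.
have DK j : (j <= D)%N -> a <= (k + j)%:R <= a + d.
  rewrite -(ler_nat R) natrD => jD; apply/andP; split; last lra.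
  by have : 0 <= j%:R :> R by [rewrite ler0n]; lra.
have sub : {subset iota k D.+1 <= map val (enum P)}.
  move=> m; rewrite mem_iota => /andP[km mkD].
  have := DK (m - k)%N; rewrite subnKC// => /(_ _)/andP[|am mad]; first lia.
  have mK : (m < K)%N by rewrite -(ltr_nat R); apply: le_lt_trans adK.
  by apply/mapP; exists (Ordinal mK) => //=; rewrite mem_enum inE /= am mad.
have := uniq_leq_size (iota_uniq _ _) sub.
rewrite size_map -cardE size_iota -(ler_nat R); exact/le_trans/ltW.
Qed.

End Counting.

Lemma card_le_union (T I : finType) (P : pred T) (Q : I -> pred T) :
  (forall x, P x -> exists i, Q i x) -> (#|P| <= \sum_i #|Q i|)%N.
Proof.
move=> PQ; rewrite -sum1_card big_mkcond /=.
under [leqRHS]eq_bigr do rewrite -sum1_card big_mkcond /=.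
rewrite exchange_big /=; apply: leq_sum => x _; case: ifP => // /PQ[i Qix].
by rewrite (bigD1 i)//= ifT.
Qed.

(** * Fractions with denominator b^n, their shells, and the number of children of a shell *)

Section Nested.
Variables (R : realType) (b : nat) (f : nat -> R).
Hypothesis b2 : (2 <= b)%N.
Hypothesis f0 : forall n, 0 < f n.
Hypothesis fle : forall m n, (m <= n)%N -> f n <= f m.
Implicit Types (n m : nat) (z y : int) (e : R).

Local Notation B n := (b%:R ^+ n : R).

Definition bfrac n z : R := z%:~R / B n.

(** Points that the centre approximates within [f n], but not within [t * f n] for any t <= 1 - 2e.
    The shell has length [e * f n]. *)
Definition shell n z e : set R :=
  [set x | bfrac n z + (1 - 2 * e) * f n <= x <= bfrac n z + (1 - e) * f n].

(* The last clause ranges over the levels m from n to n' - 1 and over the fractions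
   y/b^m other than the centre of the parent, whose balls the parent shell
   avoids anyway; the summand b^-n'/2 leaves room for the child shell itself. *)
Definition child n z e n' z' : Prop :=
  [/\ (n < n')%N, bfrac n z + (1 - 2 * e) * f n <= bfrac n' z',
      bfrac n' z' + f n' <= bfrac n z + (1 - e) * f n &
      forall m y, (n <= m < n')%N -> bfrac m y != bfrac n z ->
        f m + (B n')^-1 / 2 <= `|bfrac n' z' - bfrac m y| ].

Lemma bpow_gt0 n : 0 < B n.
Proof. by rewrite exprn_gt0// ltr0n; lia. Qed.
Hint Resolve bpow_gt0 : core.

Lemma bpow_neq0 n : B n != 0. Proof. by rewrite gt_eqF. Qed.

Lemma bfrac_lift n m z : (n <= m)%N -> bfrac n z = bfrac m (z * (b ^ (m - n))%N%:Z).
Proof.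
move=> nm; rewrite /bfrac intrM -pmulrn natrX -{2}(subnKC nm) exprD.
field; by rewrite !bpow_neq0.
Qed.

Lemma bfrac_sep m z z' : bfrac m z != bfrac m z' -> (B m)^-1 <= `|bfrac m z - bfrac m z'|.
Proof.
move=> zz'; rewrite /bfrac -mulrBl normrM (gtr0_norm (_ : 0 < (B m)^-1)) ?invr_gt0//.
rewrite ler_peMl ?invr_ge0 ?(ltW (bpow_gt0 m))// -rmorphB /= -intr_norm.
have : z - z' != 0 by apply: contraNneq zz' => /subr0_eq ->.
by rewrite -normr_gt0 gtz0_ge1 -(ler_int R).
Qed.

Lemma bfrac_sep_le n m z z' : (n <= m)%N -> bfrac n z != bfrac m z' ->
  (B m)^-1 <= `|bfrac n z - bfrac m z'|.
Proof. by move=> /bfrac_lift -> /bfrac_sep. Qed.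

(** The numerator is 1 modulo [b], whereas a fraction of lower level lifted to level [n] has a
    numerator divisible by [b]. *)
Lemma bfrac_new_neq m n z (q : nat) : (m < n)%N -> bfrac n (b * q + 1)%N != bfrac m z.
Proof.
move=> mn; rewrite (bfrac_lift _ (ltnW mn)) /bfrac.
apply/eqP => /(mulIf (invr_neq0 (bpow_neq0 n))) /eqP; rewrite eqr_int => /eqP H.
have : (b %| `|(z * (b ^ (n - m))%N%:Z)%R|)%N.
  by rewrite abszM dvdn_mull// absz_nat -[X in (_ %| b ^ X)%N]prednK ?subn_gt0// expnS dvdn_mulr.
rewrite -H absz_nat dvdn_addr ?dvdn_mulr// dvdn1; lia.
Qed.

Lemma child_sub n z e n' z' e' : 0 < e' < 2^-1 -> child n z e n' z' ->
  shell n' z' e' `<=` shell n z e.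
Proof.
move=> /andP[e0 e1] [_ lo hi _] x /andP[xl xr]; have := f0 n'.
by move=> fn'; apply/andP; split; nra.
Qed.

(* At most 6 f(n) b^m fractions y/b^m other than the centre are near the
   shell, and each spoils at most 6 f(m) b^n' of the candidates. *)
Lemma card_bad_le K n z e n' m : 0 < e < 2^-1 -> (n <= m < n')%N ->
  (B n')^-1 <= f n ->
  #|[pred q : 'I_K | `[< bfrac n z + (1 - 2 * e) * f n <= bfrac n' (b * q + 1)%N /\
      bfrac n' (b * q + 1)%N + f n' <= bfrac n z + (1 - e) * f n /\
      exists2 y, bfrac m y != bfrac n z &
        `|bfrac n' (b * q + 1)%N - bfrac m y| < f m + (B n')^-1 / 2 >] ]|%:R
  <= 36 * f n * (B m * f m) * B n'.
Proof.
move=> /andP[e0 e1] /andP[nm mn'] Bf.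
(* The spoiling fraction lies within [3 * f n] of the centre: less than [f n] from centre to
   candidate, and at most 3/2 [f n] from there on. [Q] indexes such fractions by side and by
   distance in steps of b^-m. *)
set kk := Num.truncn (3 * f n * B m).
pose w := z * (b ^ (m - n))%N%:Z.
have ptw : bfrac n z = bfrac m w by apply: bfrac_lift.
pose Q (i : bool * 'I_kk) (q : 'I_K) :=
  `|bfrac n' (b * q + 1)%N - bfrac m (w + (-1) ^+ i.1 * i.2.+1%:Z)| < f m + (B n')^-1 / 2.
have fn0 := f0 n; have fm0 := f0 m; have fn'0 := f0 n'.
have fmn := fle nm; have Bm0 := bpow_gt0 m; have Bn0 := bpow_gt0 n'.
have Bn'i : 0 < (B n')^-1 by rewrite invr_gt0.
set P := [pred q : 'I_K | _].
have PQ q : P q -> exists i, Q i q.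
  move=> /asboolP[lo [hi [y yz yq]]].
  have yw : y - w != 0.
    by apply: contraNneq yz => /subr0_eq ->; rewrite ptw.
  have close : `|bfrac m y - bfrac m w| <= 3 * f n.
    rewrite -ptw ler_norml; move: yq; rewrite ltr_norml => /andP[y1 y2].
    apply/andP; split; nra.
  have absle : (`|y - w|%N%:R : R) <= 3 * f n * B m.
    move: close; rewrite /bfrac -mulrBl normrM (gtr0_norm (_ : 0 < (B m)^-1)) ?invr_gt0//.
    by rewrite ler_pdivrMr// -rmorphB /= -intr_norm natr_absz.
  have lt : (`|y - w|.-1 < kk)%N.
    rewrite prednK ?absz_gt0// truncn_ge_nat//; nra.
  exists (y - w < 0, Ordinal lt).
  rewrite /Q /= prednK ?absz_gt0//.
  by rewrite -intEsign [w + _]addrC subrK.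
have Qle i : #|Q i|%:R <= 6 * f m * B n'.
  have [q0 Qq0|Q0] := pickP (Q i); last first.
    by rewrite (eq_card0 Q0) !mulr_ge0//; nra.
  set y := w + (-1) ^+ i.1 * i.2.+1%:Z.
  (* The spoiled candidate differs from the fraction [y], so the two are at least b^-n' apart; this
     bounds [f m] from below and lets the additive constants of the count be absorbed into
     [6 * f m * B n']. *)
  have half : 1 <= 2 * f m * B n'.
    have := bfrac_sep_le (ltnW mn') (_ : bfrac m y != bfrac n' (b * q0 + 1)%N).
    rewrite eq_sym bfrac_new_neq// => /(_ isT); rewrite distrC => H1.
    have H2 : (B n')^-1 / 2 < f m by move: Qq0; rewrite /Q -/y; lra.
    apply: (@le_trans _ _ ((B n')^-1 * B n')); first by rewrite mulVf ?bpow_neq0.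
    by rewrite ler_pM2r//; lra.
  have := @card_ord_le_width R K (Q i) (2 * f m * B n' + 1) _ _.
  move=> H; apply: (le_trans (H _ _)); [nra| |nra].
  move=> q1 q2; rewrite /Q -/y !ltr_norml => /andP[a1 a2] /andP[c1 c2].
  have : bfrac n' (b * q2 + 1)%N - bfrac n' (b * q1 + 1)%N <= 2 * f m + (B n')^-1 by lra.
  rewrite /bfrac -mulrBl ler_pdivrMr// mulrDl mulVf ?bpow_neq0//.
  rewrite -!pmulrn !natrD !natrM.
  have [q12|q12] := leP (q2%:R : R) q1%:R; first by move=> _; nra.
  have : (2 : R) <= b%:R by rewrite ler_nat.
  by move=> ? ?; nra.
apply: (@le_trans _ _ (\sum_i #|Q i|)%:R); first by rewrite ler_nat card_le_union.
rewrite natr_sum; apply: (le_trans (ler_sum _ (fun i _ => Qle i))).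
rewrite sumr_const card_prod card_bool card_ord -[_ *+ _]mulr_natr natrM.
have : (kk%:R : R) <= 3 * f n * B m by rewrite truncn_le; nra.
have : 0 < f m * B n' by rewrite mulr_gt0.
by move=> ? ?; nra.
Qed.

(** Of about X = e f(n) b^n' / b candidates in the parent shell, the room [f n'] costs at most X/4,
    rounding at most X/4, and spoiled candidates at most X/4, by [card_bad_le] summed over the
    levels (36 * 4 = 144). So X/4 remain. *)
Lemma card_child_ge K n z e n' : 0 < e <= 4^-1 -> (n < n')%N -> 0 <= z ->
  f n' <= e * f n / 4 -> (B n')^-1 <= f n -> 4 * b%:R <= e * f n * B n' ->
  \sum_(n <= m < n') B m * f m <= e / (144 * b%:R) ->
  (bfrac n z + f n) * B n' < K%:R ->
  e * f n * B n' / (4 * b%:R) <=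
  #|[pred q : 'I_K | `[< child n z e n' (b * q + 1)%N >] ]|%:R.
Proof.
move=> /andP[e0 e1] nn' z0 fn' Bf big tail Klt.
have bR : (2 : R) <= b%:R by rewrite ler_nat.
have bgt0 : (0 : R) < b%:R by lra.
have fn0 := f0 n; have fn'0 := f0 n'; have Bn'0 := bpow_gt0 n'.
have pt0 : 0 <= bfrac n z by rewrite divr_ge0 ?ler0z// ltW.
have efB : e * f n * B n' <= f n * B n' / 4.
  by rewrite -[leRHS]mulrC mulrA ler_pM2r// ler_pM2r.
have efB0 : 0 < e * f n * B n' by rewrite !mulr_gt0.
have f'B0 : 0 < f n' * B n' by rewrite mulr_gt0.
have ptB0 : 0 <= bfrac n z * B n' by rewrite mulr_ge0// ltW.
(* The first two inequalities required of a child, solved for [q], read [a <= q <= a + d]. *)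
pose a : R := ((bfrac n z + (1 - 2 * e) * f n) * B n' - 1) / b%:R.
pose d : R := (e * f n - f n') * B n' / b%:R.
have a0 : 0 <= a by rewrite divr_ge0//; nra.
have adK : a + d < K%:R.
  rewrite -mulrDl ltr_pdivrMr//.
  apply: (@lt_le_trans _ _ K%:R); last by rewrite ler_peMr ?ler0n//; lra.
  apply: le_lt_trans Klt.
  have -> : (bfrac n z + (1 - 2 * e) * f n) * B n' - 1 + (e * f n - f n') * B n' =
    (bfrac n z + f n) * B n' - e * f n * B n' - f n' * B n' - 1 by ring.
  lra.
have := card_ord_ge_width a0 adK.
set cand := [pred i | _] => candge.
pose bad m := [pred q : 'I_K |
  `[< bfrac n z + (1 - 2 * e) * f n <= bfrac n' (b * q + 1)%N /\
      bfrac n' (b * q + 1)%N + f n' <= bfrac n z + (1 - e) * f n /\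
      exists2 y, bfrac m y != bfrac n z &
        `|bfrac n' (b * q + 1)%N - bfrac m y| < f m + (B n')^-1 / 2 >] ].
pose ok := [pred q : 'I_K | `[< child n z e n' (b * q + 1)%N >] ].
have candE q : cand q -> bfrac n z + (1 - 2 * e) * f n <= bfrac n' (b * q + 1)%N /\
      bfrac n' (b * q + 1)%N + f n' <= bfrac n z + (1 - e) * f n.
  rewrite /cand /= /a /d -mulrDl ler_pdivrMr// ler_pdivlMr// => /andP[q1 q2].
  have -> : bfrac n' (b * q + 1)%N = (b%:R * q%:R + 1) / B n'.
    by rewrite /bfrac -pmulrn natrD natrM.
  split; first by rewrite ler_pdivlMr//; lra.
  by rewrite -lerBrDr ler_pdivrMr//; lra.
have split_cand q : cand q -> exists i : bool, if i then ok q else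
    [exists m : 'I_n', (n <= m)%N && bad m q].
  move=> cq; have [q1 q2] := candE _ cq.
  have [okq|nokq] := boolP (ok q); [by exists true|exists false].
  apply: contraNT nokq => nobad; apply/asboolP; split=> // m y /andP[nm mn'] my.
  rewrite leNgt; apply: contra nobad => lt; apply/existsP.
  by exists (Ordinal mn'); rewrite nm; apply/asboolP; split=> //; split=> //; exists y.
have badle m : (n <= m < n')%N -> #|bad m|%:R <= 36 * f n * (B m * f m) * B n'.
  by move=> nm; apply: card_bad_le => //; rewrite e0; lra.
have := card_le_union split_cand; rewrite big_bool /= -(ler_nat R) natrD.
set okc := (X in X%:R + _); set badc := (X in _ + X%:R) => union.
have okE : okc = #|ok| by apply: eq_card.
have : badc%:R <= 36 * f n * B n' * (e / (144 * b%:R)).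
  have : (badc <= \sum_(m < n' | (n <= m)%N) #|bad m|)%N.
    rewrite big_mkcond /=.
    have := @card_le_union _ _ [pred q | [exists m : 'I_n', (n <= m)%N && bad m q]]
      (fun m : 'I_n' => [pred q | (n <= m)%N && bad m q]).
    move=> /(_ _)/leq_trans; apply; first by move=> q /existsP.
    by apply: leq_sum => m _; case: (n <= m)%N => //=; rewrite eq_card0.
  rewrite -(ler_nat R) => /le_trans; apply; rewrite natr_sum.
  apply: (@le_trans _ _ (\sum_(m < n' | (n <= m)%N) 36 * f n * B n' * (B m * f m))).
    by apply: ler_sum => m nm; rewrite mulrAC; apply: badle; rewrite nm /=.
  rewrite -mulr_sumr ler_pM2l ?mulr_gt0//.
  by move: tail; rewrite big_geq_mkord.
have -> : 36 * f n * B n' * (e / (144 * b%:R)) = e * f n * B n' / b%:R / 4.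
  by field; lra.
have big' : 4 <= e * f n * B n' / b%:R by rewrite ler_pdivlMr//; lra.
have fB : f n' * B n' / b%:R <= e * f n * B n' / b%:R / 4.
  have -> : e * f n * B n' / b%:R / 4 = e * f n / 4 * (B n' / b%:R) by ring.
  by rewrite -mulrA ler_pM2r ?divr_gt0.
have dE : d = e * f n * B n' / b%:R - f n' * B n' / b%:R by rewrite /d -!mulrBl.
have -> : e * f n * B n' / (4 * b%:R) = e * f n * B n' / b%:R / 4 by field; lra.
by rewrite -okE; move: union candge; rewrite dE; lra.
Qed.

(** * The share of the candidates' weight charged to a single set *)

Variable s : R.
Hypothesis s01 : 0 < s < 1.
Variable n0 : nat.
Hypothesis fsmall : forall n, (n0 <= n)%N -> f n <= (B n)^-1 / 8.

Definition hit (U : set R) n z e : bool := `[< U `&` shell n z e !=set0 >].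

(* [cost r n e] bounds the relative mass that a set of diameter [r] would have in a
   shell of length [e * f n]. *)
Definition cost (r : R) n e : R :=
  Num.min 1 (48 * b%:R * (r / (e * f n)) `^ s).

Lemma cost_ge0 r n e : 0 <= cost r n e.
Proof. by rewrite le_min ler01 /= !mulr_ge0// powR_ge0. Qed.

Lemma sum_le_at_most_one (T : finType) (P : pred T) (F : T -> R) (C : R) :
  0 <= C -> (forall x x', P x -> P x' -> x = x') -> (forall x, P x -> F x <= C) ->
  \sum_(x | P x) F x <= C.
Proof.
move=> C0 P1 FC; have [x Px|P0] := pickP P; last by rewrite big_pred0.
rewrite (big_pred1 x); first exact: FC.
by move=> x' /=; apply/idP/eqP => [Py|->//]; apply: P1.
Qed.

Lemma shell_center n z e x : 0 < e <= 4^-1 -> shell n z e x -> `|x - bfrac n z| <= f n.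
Proof.
by move=> /andP[e0 e1] /andP[xl xr]; have := f0 n => ?; rewrite ler_norml; apply/andP; split; nra.
Qed.

Section OneSet.
Variables (U : set R) (r : R).
Hypothesis r0 : 0 < r.
Hypothesis Ur : forall x y : R, U x -> U y -> `|x - y| <= r.
Variables (n : nat) (z : int) (e e' : R) (N M K : nat).
Hypothesis e'01 : 0 < e' <= 4^-1.
Hypothesis Nn0 : (n0 <= N)%N.

Definition candidate (x : 'I_M * 'I_K) : bool :=
  (N <= x.1)%N && `[< child n z e x.1 (b * x.2 + 1)%N >].

(** Both centres are within [r + f x.1 + f y.1] of each other. For different levels this contradicts
    the separation clause of [child] for the finer one, as 1/4 + 1/8 < 1/2; for equal levels it is
    less than the spacing of distinct fractions. *)
Lemma small_hit_unique (x y : 'I_M * 'I_K) :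
  candidate x -> hit U x.1 (b * x.2 + 1)%N e' -> r <= (B x.1)^-1 / 4 ->
  candidate y -> hit U y.1 (b * y.2 + 1)%N e' -> r <= (B y.1)^-1 / 4 ->
  x = y.
Proof.
wlog xy : x y / (x.1 <= y.1)%N.
  by move=> H; case: (leqP x.1 y.1) => [|/ltnW] xy *; [|symmetry]; apply: H.
move=> /andP[Nx /asboolP chx] /asboolP[u [Uu Ju]] rx.
move=> /andP[Ny /asboolP chy] /asboolP[v [Uv Jv]] ry.
have := Ur Uu Uv; have := shell_center e'01 Ju; have := shell_center e'01 Jv.
have := fsmall (leq_trans Nn0 Ny).
have Bi : 0 < (B y.1)^-1 by rewrite invr_gt0.
set c := bfrac y.1 _; set d := bfrac x.1 _ => fB cv du uv.
have cd : `|c - d| <= r + f x.1 + f y.1.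
  move: cv du uv; rewrite !ler_norml => /andP[? ?] /andP[? ?] /andP[? ?].
  by apply/andP; split; lra.
have [xy1|xy1] := ltnP x.1 y.1.
  have : f x.1 + (B y.1)^-1 / 2 <= `|c - d|.
    have [nx1 _ _ _] := chx; have [_ _ _] := chy; apply; last exact: bfrac_new_neq.
    by rewrite (ltnW nx1).
  by move=> ?; exfalso; lra.
have E1 : x.1 = y.1 by apply: val_inj; apply/eqP; rewrite eqn_leq xy.
have [cd'|] := eqVneq c d; last first.
  by move: cd; rewrite /c /d E1 => ? /bfrac_sep ?; exfalso; lra.
have /eqP : ((b * y.2 + 1)%N%:R : R) = (b * x.2 + 1)%N%:R.
  have /(congr1 (fun t => t * B y.1)) := cd'.
  by rewrite /c /d E1 /bfrac !divfK ?bpow_neq0.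
rewrite eqr_nat eqn_add2r eqn_pmul2l ?(ltnW b2)// => /eqP E2.
case: x y E1 E2 {xy Nx chx Ju rx Ny chy Jv ry Bi cd' c d fB cv du uv cd xy1} => [x1 x2] [y1 y2] /= -> E2.
by congr (_, _); apply: val_inj.
Qed.

(** At most one term survives, and in it the factor [f x.1 ^ s] cancels against the second branch of
    [cost]. *)
Lemma sum_hit_small :
  \sum_(x | candidate x && (hit U x.1 (b * x.2 + 1)%N e' && (r <= (B x.1)^-1 / 4)))
    f x.1 `^ s * cost r x.1 e' <= 48 * b%:R * (e'^-1) `^ s * r `^ s.
Proof.
have /andP[e'0 _] := e'01.
apply: sum_le_at_most_one.
- by rewrite !mulr_ge0// powR_ge0.
- by move=> x y /and3P[? ? ?] /and3P[? ? ?]; apply: small_hit_unique.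
move=> x _; rewrite -mulrA -powRM ?invr_ge0 ?(ltW e'0) ?(ltW r0)//.
have -> : e'^-1 * r = f x.1 * (r / (e' * f x.1)).
  by field; rewrite !gt_eqF// f0.
rewrite powRM ?(ltW (f0 _))//; last by rewrite ltW// divr_gt0// mulr_gt0.
by rewrite [leRHS]mulrCA ler_wpM2l ?powR_ge0// /cost ge_min lexx orbT.
Qed.

(** Here the cost is bounded by 1 and the hit candidates are counted: a set with r > b^-m / 4 meets
    at most 6 r b^m candidates of level [m]. *)
Lemma sum_hit_large :
  \sum_(x | candidate x && (hit U x.1 (b * x.2 + 1)%N e' && ~~ (r <= (B x.1)^-1 / 4)))
    f x.1 `^ s * cost r x.1 e' <= 6 * r * \sum_(N <= m < M) B m * f m `^ s.
Proof.
rewrite [X in _ * X]big_geq_mkord mulr_sumr /=.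
set Q := fun (m : 'I_M) (q : 'I_K) => `[< child n z e m (b * q + 1)%N >] &&
  (hit U m (b * q + 1)%N e' && ~~ (r <= (B m)^-1 / 4)).
apply: (@le_trans _ _ (\sum_(m < M | (N <= m)%N) \sum_(q < K | Q m q) f m `^ s)).
  rewrite pair_big_dep /= [leRHS](eq_bigl (fun x => candidate x && 
    (hit U x.1 (b * x.2 + 1)%N e' && ~~ (r <= (B x.1)^-1 / 4)))); last first.
    by move=> x; rewrite /candidate /Q -andbA.
  by apply: ler_sum => x _; rewrite ler_piMr ?powR_ge0// /cost ge_min lexx.
apply: ler_sum => m Nm; rewrite sumr_const -[_ *+ _]mulr_natl mulrA.
rewrite ler_wpM2r ?powR_ge0//.
have [q0 Qq0|Q0] := pickP (Q m); last first.
  by rewrite (eq_card0 Q0) !mulr_ge0// ltW.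
have rB : 1 / 4 < r * B m.
  by move: Qq0 => /and3P[_ _]; rewrite -ltNge mulrC ltr_pdivrMr// mulrC; lra.
have := fsmall (leq_trans Nn0 Nm); have := f0 m; have Bm := bpow_gt0 m => fm fB.
have fB8 : f m * B m <= 1 / 8.
  by move: fB; rewrite -ler_pdivlMr// => /le_trans; apply; lra.
have := @card_ord_le_width R K (Q m) (r * B m + 1 / 8) _ _.
move=> H; apply: (le_trans (H _ _)); [lra| |lra].
move=> i j /and3P[_ /asboolP[u [Uu /andP[u1 u2]]] _].
move=> /and3P[_ /asboolP[v [Uv /andP[v1 v2]]] _].
have := Ur Uu Uv; rewrite ler_norml => /andP[uv1 uv2].
have /andP[e'0 e'1] := e'01.
have : bfrac m (b * j + 1)%N - bfrac m (b * i + 1)%N <= r + f m by nra.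
rewrite /bfrac -mulrBl ler_pdivrMr// -!pmulrn !natrD !natrM.
have [ij|ij] := leP (j%:R : R) i%:R; first by move=> _; lra.
have : (2 : R) <= b%:R by rewrite ler_nat.
by move=> ? ?; nra.
Qed.

End OneSet.

(** A set missing the parent shell misses every child shell. Otherwise the sum is at most [W]
    because costs are at most 1, and it also splits into the small part, at most [xi * W * r ^ s],
    and the large part, where the lower bound on [W] turns 6 r into 24 b r / (e f(n)) times [W]. *)
Lemma sum_candidate_le (U : set R) (r : R) n z e e' N M K xi :
  0 < r -> (forall x y : R, U x -> U y -> `|x - y| <= r) ->
  0 < e -> 0 < e' <= 4^-1 -> (n0 <= N)%N -> 0 < xi ->
  let W := \sum_(x : 'I_M * 'I_K | candidate n z e N x) f x.1 `^ s in
  e * f n / (4 * b%:R) * \sum_(N <= m < M) B m * f m `^ s <= W ->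
  48 * b%:R * (e'^-1) `^ s <= xi * W ->
  \sum_(x : 'I_M * 'I_K | candidate n z e N x)
    f x.1 `^ s * ((hit U x.1 (b * x.2 + 1)%N e')%:R * cost r x.1 e') <=
  W * ((hit U n z e)%:R * Num.min 1 (24 * b%:R / (e * f n) * r + xi * r `^ s)).
Proof.
move=> r0 Ur e0 e'01 Nn0 xi0 W WS Wxi.
have W0 : 0 <= W by apply: sumr_ge0 => x _; rewrite powR_ge0.
have bR : (0 : R) < b%:R by rewrite ltr0n ltnW.
have fn0 := f0 n.
have [hitI|nhitI] := boolP (hit U n z e); last first.
  rewrite mul0r mulr0 big1// => x /andP[_ /asboolP ch].
  suff -> : hit U x.1 (b * x.2 + 1)%N e' = false by rewrite mul0r mulr0.
  apply: contraNF nhitI => /asboolP[u [Uu Ju]]; apply/asboolP; exists u.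
  split=> //; apply: child_sub ch _ Ju.
  by move: e'01 => /andP[-> ?]; lra.
have le1 : \sum_(x : 'I_M * 'I_K | candidate n z e N x)
    f x.1 `^ s * ((hit U x.1 (b * x.2 + 1)%N e')%:R * cost r x.1 e') <= W.
  apply: ler_sum => x _; rewrite ler_piMr ?powR_ge0//.
  case: hit; last by rewrite mul0r.
  by rewrite mul1r /cost ge_min lexx.
rewrite mul1r minr_pMr// mulr1 le_min le1 /=.
have -> : \sum_(x : 'I_M * 'I_K | candidate n z e N x)
    f x.1 `^ s * ((hit U x.1 (b * x.2 + 1)%N e')%:R * cost r x.1 e') =
  \sum_(x : 'I_M * 'I_K | candidate n z e N x && hit U x.1 (b * x.2 + 1)%N e')
    f x.1 `^ s * cost r x.1 e'.
  rewrite [RHS]big_mkcondr; apply: eq_bigr => x _.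
  by case: hit; rewrite ?mul1r// mul0r mulr0.
rewrite (bigID (fun x : 'I_M * 'I_K => r <= (B x.1)^-1 / 4)) /=.
under eq_bigl do rewrite -andbA.
under [X in _ + X]eq_bigl do rewrite -andbA.
have small := sum_hit_small r0 Ur n z e M K e'01 Nn0.
have large := sum_hit_large r0 Ur n z e M K e'01 Nn0.
apply: (le_trans (lerD small large)).
set S := \sum_(N <= m < M) _ in WS *.
have : S <= W * (4 * b%:R / (e * f n)).
  rewrite mulrA ler_pdivlMr ?mulr_gt0//; move: WS.
  rewrite [_ / _ * S]mulrAC ler_pdivrMr ?mulr_gt0//.
  by rewrite mulrC.
move=> SW.
have -> : W * (24 * b%:R / (e * f n) * r + xi * r `^ s) =
  xi * W * r `^ s + 6 * r * (W * (4 * b%:R / (e * f n))) by ring.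
apply: lerD; first by rewrite ler_wpM2r ?powR_ge0.
by rewrite ler_pM2l// mulr_gt0.
Qed.

(** * Choosing a child by the weighted mean *)

Hypothesis div : forall N C, exists M, C <= \sum_(N <= m < M) B m * f m `^ s.

Lemma bpow_inv_small x : 0 < x -> exists N, forall n, (N <= n)%N -> (B n)^-1 <= x.
Proof.
move=> x0; exists (Num.truncn x^-1).+1 => n Nn.
have ix0 : 0 <= x^-1 by rewrite invr_ge0 ltW.
have /andP[_ lt] := truncn_itv ix0.
rewrite -[leRHS]invrK lef_pV2 ?posrE ?invr_gt0//.
apply: (le_trans (ltW lt)); apply: (@le_trans _ _ n%:R); first by rewrite ler_nat.
by rewrite -natrX ler_nat ltnW// ltn_expl.
Qed.

(** If every candidate had load at least 1, then weighting by [f ^ s], exchanging the sums and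
    applying [sum_candidate_le] to each set would give W <= W * (parent load) < W. *)
Lemma exists_light_child (U : nat -> set R) (r : nat -> R) n z e e' N xi :
  (forall i, 0 < r i) -> (forall i (x y : R), U i x -> U i y -> `|x - y| <= r i) ->
  0 < e <= 4^-1 -> 0 < e' <= 4^-1 -> 0 <= z -> 0 < xi ->
  (forall M, \sum_(n <= m < M) B m * f m <= e / (144 * b%:R)) ->
  (\sum_(0 <= i <oo) ((hit (U i) n z e)%:R *
     Num.min 1 (24 * b%:R / (e * f n) * r i + xi * r i `^ s))%:E < 1%:E)%E ->
  exists n' z', [/\ (N <= n')%N, 0 <= z', child n z e n' z' &
    (\sum_(0 <= i <oo) ((hit (U i) n' z' e')%:R * cost (r i) n' e')%:E < 1%:E)%E].
Proof.
move=> r0 Ur e01 e'01 z0 xi0 tail load.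
have /andP[e0 e1] := e01; have /andP[e'0 e'1] := e'01.
have bR : (0 : R) < b%:R by rewrite ltr0n ltnW.
have fn0 := f0 n.
have efn0 : 0 < e * f n by rewrite mulr_gt0.
have [N1 HN1] := @bpow_inv_small (e * f n / (4 * b%:R)) (divr_gt0 efn0 (mulr_gt0 (ltr0n _ 4) bR)).
have bR2 : (2 : R) <= b%:R by rewrite ler_nat.
(* From level [N'] on, the parent shell is long enough relative to b^-n' for [card_child_ge], and
   [fsmall] applies. *)
set N' := maxn N (maxn n.+1 (maxn n0 N1)).
have [NN' nN' n0N' N1N'] : [/\ (N <= N')%N, (n < N')%N, (n0 <= N')%N & (N1 <= N')%N].
  by rewrite /N' !leq_max !leqnn !orbT.
have level K n' : (N' <= n')%N -> (bfrac n z + f n) * B n' < K%:R ->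
    e * f n * B n' / (4 * b%:R) <=
    #|[pred q : 'I_K | `[< child n z e n' (b * q + 1)%N >] ]|%:R.
  move=> N'n' KB; have Bn' := bpow_gt0 n'.
  have Bi : 0 < (B n')^-1 by rewrite invr_gt0.
  have Bs := HN1 n' (leq_trans N1N' N'n').
  have Bs' : (B n')^-1 <= e * f n.
    apply: (le_trans Bs); rewrite ler_pdivrMr ?mulr_gt0//.
    by rewrite ler_peMr ?ltW//; lra.
  apply: card_child_ge => //.
  - exact: leq_trans N'n'.
  - by have := fsmall (leq_trans n0N' N'n'); lra.
  - by apply: (le_trans Bs'); rewrite ler_piMl ?ltW//; lra.
  - move: Bs; rewrite ler_pdivlMr ?mulr_gt0// mulrC ler_pdivrMr//.
pose Wlow := (e * f n / (4 * b%:R)).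
have Wlow0 : 0 < Wlow by rewrite divr_gt0// mulr_gt0.
(* By divergence the levels below [M] carry so much weight that the bound of [sum_hit_small] is at
   most [xi * W]. *)
have [M HM] := div N' (48 * b%:R * (e'^-1) `^ s / (xi * Wlow)).
have pf0 : 0 <= bfrac n z + f n.
  by rewrite addr_ge0 ?(ltW fn0)// divr_ge0 ?ler0z// (ltW (bpow_gt0 n)).
have pB0 : 0 <= (bfrac n z + f n) * B M by rewrite mulr_ge0// (ltW (bpow_gt0 M)).
set K := (Num.truncn ((bfrac n z + f n) * B M)).+1.
have KM : (bfrac n z + f n) * B M < K%:R by have /andP[] := truncn_itv pB0.
set W := \sum_(x : 'I_M * 'I_K | candidate n z e N' x) f x.1 `^ s.
have WS : Wlow * \sum_(N' <= m < M) B m * f m `^ s <= W.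
  rewrite /W /candidate -(pair_big_dep (fun m : 'I_M => (N' <= m)%N)
    (fun (m : 'I_M) (q : 'I_K) => `[< child n z e m (b * q + 1)%N >])
    (fun (m : 'I_M) (_ : 'I_K) => f m `^ s)) /=.
  rewrite big_geq_mkord mulr_sumr /=; apply: ler_sum => m N'm.
  rewrite sumr_const -[leRHS]mulr_natl mulrA ler_wpM2r ?powR_ge0//.
  have -> : Wlow * B m = e * f n * B m / (4 * b%:R) by rewrite /Wlow mulrAC.
  apply: level => //; apply: le_lt_trans KM; rewrite ler_wpM2l//.
  by apply: ler_weXn2l; [lra|exact: ltnW (ltn_ord m)].
have Wxi : 48 * b%:R * (e'^-1) `^ s <= xi * W.
  apply: (@le_trans _ _ (xi * (Wlow * \sum_(N' <= m < M) B m * f m `^ s))).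
    have := HM; rewrite (ler_pdivrMr _ _ (mulr_gt0 xi0 Wlow0)) => /le_trans; apply.
    by rewrite [leRHS]mulrA [leRHS]mulrC.
  by rewrite ler_pM2l.
have W0 : 0 < W.
  rewrite -(pmulr_rgt0 _ xi0); apply: lt_le_trans Wxi.
  by rewrite !mulr_gt0// powR_gt0// invr_gt0.
apply: contrapT => nochild.
pose g (x : 'I_M * 'I_K) i : R :=
  (hit (U i) x.1 (b * x.2 + 1)%N e')%:R * cost (r i) x.1 e'.
have g0 x i : 0 <= g x i by rewrite mulr_ge0// cost_ge0.
have big x : candidate n z e N' x -> (1%:E <= \sum_(0 <= i <oo) (g x i)%:E)%E.
  move=> /andP[N'x /asboolP ch]; rewrite leNgt; apply/negP => lt; apply: nochild.
  by exists x.1, (b * x.2 + 1)%N; split=> //; exact: leq_trans N'x.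
have : (W%:E <= W%:E * \sum_(0 <= i <oo) ((hit (U i) n z e)%:R *
     Num.min 1 (24 * b%:R / (e * f n) * r i + xi * r i `^ s))%:E)%E.
  have min0 i : 0 <= (hit (U i) n z e)%:R *
     Num.min 1 (24 * b%:R / (e * f n) * r i + xi * r i `^ s).
    rewrite mulr_ge0// le_min ler01 /= addr_ge0 ?mulr_ge0 ?powR_ge0// ?invr_ge0 ?ltW//.
  apply: (@le_trans _ _ (\sum_(x | candidate n z e N' x)
      (f x.1 `^ s)%:E * \sum_(0 <= i <oo) (g x i)%:E)%E).
    rewrite -sumEFin; apply: lee_sum => x fx.
    by rewrite -[leLHS]mule1 lee_wpmul2l ?lee_fin ?powR_ge0// big.
  under eq_bigr => x _.
    rewrite -nneseriesZl; last by move=> i _; rewrite lee_fin.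
    over.
  rewrite -nneseries_sum; last first.
    by move=> x i _; rewrite mule_ge0// lee_fin// powR_ge0.
  rewrite -nneseriesZl; last by move=> i _; rewrite lee_fin.
  apply: lee_nneseries => i _.
    by move=> _; apply: sume_ge0 => x _; rewrite mule_ge0// lee_fin// powR_ge0.
  under eq_bigr do rewrite -EFinM.
  rewrite sumEFin -EFinM lee_fin.
  apply: (@sum_candidate_le (U i) (r i) n z e e' N' M K xi (r0 i) _ e0 e'01 n0N' xi0 _ Wxi) => //.
  exact: Ur.
apply/negP; rewrite -ltNge -[ltRHS]mule1 lte_pmul2l// lte_fin//.
Qed.

(** * Limits of nested shells: exactness and avoidance *)

Hypothesis tails : forall eta, 0 < eta ->
  exists N, forall n M, (N <= n)%N -> \sum_(n <= m < M) B m * f m <= eta.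

Lemma shell_bounds n z e x : shell n z e x ->
  (1 - 2 * e) * f n <= x - bfrac n z <= (1 - e) * f n.
Proof. by rewrite /shell /= => /andP[? ?]; apply/andP; split; lra. Qed.

(** By nesting, every left endpoint lies below every right endpoint, so the supremum of the left
    endpoints lies in all shells. *)
Lemma nested_shells_meet (n : nat -> nat) (z : nat -> int) (e : nat -> R) :
  (forall j, 0 < e j <= 4^-1) ->
  (forall j, child (n j) (z j) (e j) (n j.+1) (z j.+1)) ->
  exists x, forall j, shell (n j) (z j) (e j) x.
Proof.
move=> e01 ch.
have sub i j : (i <= j)%N -> shell (n j) (z j) (e j) `<=` shell (n i) (z i) (e i).
  elim: j => [|j IH]; first by rewrite leqn0 => /eqP ->.
  rewrite leq_eqVlt => /predU1P[->//|]; rewrite ltnS => /IH; apply: subset_trans.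
  by apply: child_sub (ch j); have /andP[-> ?] := e01 j.+1; lra.
pose a j := bfrac (n j) (z j) + (1 - 2 * e j) * f (n j).
have aJ j : shell (n j) (z j) (e j) (a j).
  rewrite /shell /= lexx /= /a; have /andP[? ?] := e01 j; have := f0 (n j); nra.
have a_le i j : a i <= bfrac (n j) (z j) + (1 - e j) * f (n j).
  have [ij|/ltnW ji] := leqP i j.
    apply: (@le_trans _ _ (a j)); first by have /andP[] := sub _ _ ij _ (aJ j).
    by have /andP[] := aJ j.
  by have /andP[] := sub _ _ ji _ (aJ i).
have ubj j : ubound (range a) (bfrac (n j) (z j) + (1 - e j) * f (n j)).
  by move=> _ [i _ <-]; exact: a_le.
exists (sup (range a)) => j; apply/andP; split.
  by apply: ub_le_sup; [exists (bfrac (n j) (z j) + (1 - e j) * f (n j))|exists j].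
by apply: ge_sup => //; exists (a 0%N), 0%N.
Qed.

(** The values of [e] along the construction: they tend to 0, and start at the largest value 1/4
    that the counting allows. *)
Definition slack k : R := (k + 4)%:R^-1.

Lemma slack01 k : 0 < slack k <= 4^-1.
Proof.
rewrite /slack invr_gt0 ltr0n addn_gt0 orbT /= lef_pV2 ?posrE ?ltr0n ?addn_gt0 ?orbT//.
by rewrite ler_nat leq_addl.
Qed.

Lemma increasing_bracket (n : nat -> nat) : (forall j, (n j < n j.+1)%N) ->
  forall j0 m, (n j0 <= m)%N -> exists2 j, (j0 <= j)%N & (n j <= m < n j.+1)%N.
Proof.
move=> ninc j0 m; elim: m => [|m IH] nm.
  exists j0 => //; rewrite nm /=; exact: leq_ltn_trans (ninc j0).
have [nm'|] := leqP (n j0) m; last first.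
  by move=> mn; exists j0 => //; rewrite nm /=; apply: leq_ltn_trans (ninc j0).
have [j j0j /andP[nj jn]] := IH nm'.
have [lt|ge] := ltnP m.+1 (n j.+1); first by exists j => //; rewrite lt (leq_trans nj).
exists j.+1; first exact: leqW.
by rewrite ge /=; apply: leq_ltn_trans (ninc _).
Qed.

(** The centres are the good approximations. For a fraction of level [m] between [n j] and [n j.+1],
    either it is the centre and the shell keeps [x] at distance at least (1 - 2e) f(n_j), or the
    separation clause applies, its summand b^-n_(j+1) / 2 exceeding the distance from [x] to the
    next centre. *)
Lemma nested_shells_exact (n : nat -> nat) (z : nat -> int) (k0 : nat) x :
  (n0 <= n 0)%N ->
  (forall j, child (n j) (z j) (slack (k0 + j)) (n j.+1) (z j.+1)) ->
  (forall j, shell (n j) (z j) (slack (k0 + j)) x) ->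
  (forall N, exists m y, (N <= m)%N /\ `|x - bfrac m y| < f m) /\
  (forall t, 0 < t < 1 -> exists N, forall m y, (N <= m)%N ->
     t * f m <= `|x - bfrac m y|).
Proof.
move=> nn0 ch Jx.
have ninc j : (n j < n j.+1)%N by have [] := ch j.
have nge j : (j <= n j)%N.
  by elim: j => // j /leq_ltn_trans; apply; exact: ninc.
have n0le j : (n0 <= n j)%N.
  by elim: j => // j IH; apply: leq_trans IH (ltnW (ninc j)).
split=> [N|t /andP[t0 t1]].
  exists (n N), (z N); split=> //.
  have /andP[? ?] := shell_bounds (Jx N); have /andP[? ?] := slack01 (k0 + N).
  by have := f0 (n N) => ?; rewrite ltr_norml; apply/andP; split; nra.
have t10 : 0 < 1 - t by lra.
set j0 := (Num.truncn (2 / (1 - t))).+1.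
have epsj j : (j0 <= j)%N -> 2 * slack (k0 + j) <= 1 - t.
  move=> j0j; have q0 : 0 <= 2 / (1 - t) by rewrite divr_ge0// ltW.
  have /andP[_ lt] := truncn_itv q0.
  rewrite /slack ler_pdivrMr ?ltr0n ?addn_gt0 ?orbT// -ler_pdivrMl//.
  rewrite mulrC; apply: (le_trans (ltW lt)); rewrite ler_nat.
  by rewrite (leq_trans j0j)// -addnA addnCA leq_addr.
exists (n j0) => m y nm.
have [j j0j /andP[njm mnj]] := increasing_bracket ninc nm.
have fm := f0 m.
have [ptE|ptN] := eqVneq (bfrac m y) (bfrac (n j) (z j)).
  rewrite ptE; have /andP[? ?] := shell_bounds (Jx j).
  have := epsj _ j0j; have := fle njm => ? ?.
  by apply: le_trans (ler_norm _); nra.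
have [_ _ _ /(_ m y)] := ch j; rewrite njm mnj ptN => /(_ isT isT) sep.
have := shell_center (slack01 _) (Jx j.+1).
have := fsmall (n0le j.+1).
have := ler_distD x (bfrac (n j.+1) (z j.+1)) (bfrac m y).
rewrite [`|_ - x|]distrC.
have : 0 < (B (n j.+1))^-1 by rewrite invr_gt0.
by move=> ? ? ? ?; nra.
Qed.

(** This links consecutive steps: the load bound obtained for a child is the one required of it as a
    parent. With a = r / (e f(n)), either a <= 1 and a <= a^s, so that 24 + 24 = 48, or a > 1 and
    the cost is 1. *)
Lemma le_cost (r : R) n e : 0 < r -> 0 < e -> 
  Num.min 1 (24 * b%:R / (e * f n) * r +
             24 * b%:R * (e * f n)^-1 `^ s * r `^ s) <= cost r n e.
Proof.
move=> r0 e0; have fn0 := f0 n; have l0 : 0 < (e * f n)^-1 by rewrite invr_gt0 mulr_gt0.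
have /andP[s0 s1] := s01.
have bR : (1 : R) <= b%:R by rewrite ler1n ltnW.
rewrite -[24 * _ / _ * r]mulrA -[24 * _ * _ * _]mulrA -powRM ?(ltW l0) ?(ltW r0)// -mulrDr.
rewrite /cost [r / _]mulrC; set a := (e * f n)^-1 * r.
have a0 : 0 < a by rewrite mulr_gt0.
rewrite le_min ge_min lexx /=.
have [a1|a1] := leP a 1.
  rewrite ge_min; apply/orP; right.
  have : a <= a `^ s by apply: ger1_powR; [rewrite a0|exact: ltW].
  by nra.
have : 1 <= a `^ s by rewrite -(powRr0 a); apply: ler_powR; exact: ltW.
by move=> ?; rewrite ge_min; apply/orP; left; nra.
Qed.

Lemma nneseries_ge_term (u : nat -> R) i : (forall j, 0 <= u j) ->
  ((u i)%:E <= \sum_(0 <= j <oo) (u j)%:E)%E.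
Proof.
move=> u0; apply: le_trans (nneseries_lim_ge i.+1 _); last by move=> j _ _; rewrite lee_fin.
by rewrite big_nat_recr//= leeDr// sume_ge0// => j _; rewrite lee_fin.
Qed.

Lemma hit_shell (U : set R) n z e x : U x -> shell n z e x -> hit U n z e.
Proof. by move=> Ux Jx; apply/asboolP; exists x. Qed.

(** Iterating [exists_light_child] keeps every load below 1. A set containing the limit point hits
    all the shells, which forces its [r i] below b^-n_j for every j, hence a contradiction with
    [r i > 0]. *)
Lemma exact_point_avoiding (C : R) : 0 < C -> exists2 delta, 0 < delta &
  forall (U : nat -> set R) (r : nat -> R),
  (forall i, 0 < r i <= delta) ->
  (forall i (x y : R), U i x -> U i y -> `|x - y| <= r i) ->
  (\sum_(0 <= i <oo) (r i `^ s)%:E <= C%:E)%E ->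
  exists x, [/\ 0 <= x <= 1,
    forall N, exists m y, (N <= m)%N /\ `|x - bfrac m y| < f m,
    forall t, 0 < t < 1 -> exists N, forall m y, (N <= m)%N ->
      t * f m <= `|x - bfrac m y| &
    forall i, ~ U i x].
Proof.
move=> C0; have /andP[s0 s1] := s01.
have bR : (0 : R) < b%:R by rewrite ltr0n ltnW.
have bR1 : (1 : R) <= b%:R by rewrite ler1n ltnW.
have /choice[Nt HNt] : forall k, exists N, forall n M, (N <= n)%N ->
    \sum_(n <= m < M) B m * f m <= slack k / (144 * b%:R).
  by move=> k; apply: tails; rewrite divr_gt0 ?mulr_gt0//; have /andP[] := slack01 k.
have half0 : 0 < 2^-1 :> R by rewrite invr_gt0.
have [N1 HN1] := bpow_inv_small half0.
set nr := maxn (Nt 0%N) (maxn n0 N1).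
have [nrt nr0 nr1] : [/\ (Nt 0 <= nr)%N, (n0 <= nr)%N & (N1 <= nr)%N].
  by rewrite /nr !leq_max !leqnn !orbT.
have fr0 := f0 nr.
have /andP[e00 e01] := slack01 0.
pose c : R := 24 * b%:R / (slack 0 * f nr).
have c0 : 0 < c by rewrite divr_gt0// mulr_gt0.
(* For r <= [delta] this gives c r <= r^s / (4C), so with [xi] = 1/(4C) the initial load is at most
   C / (2C) = 1/2. *)
pose delta : R := ((4 * C * c)^-1) `^ ((1 - s)^-1).
have Cc0 : 0 < 4 * C * c by apply: mulr_gt0 c0; rewrite mulr_gt0.
have d0 : 0 < delta by rewrite powR_gt0// invr_gt0.
exists delta => // U r rd Ur rC.
have r0 i : 0 < r i by have /andP[] := rd i.
(* The root shell is centred at 1/b^nr, with b^-nr <= 1/2, which keeps it inside [0,1]. *)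
have [n1 [z1 [N1n1 z10 ch1 load1]]] : exists n1 z1,
    [/\ (Nt 1 <= n1)%N, 0 <= z1, child nr 1 (slack 0) n1 z1 &
    (\sum_(0 <= i <oo) ((hit (U i) n1 z1 (slack 1))%:R * cost (r i) n1 (slack 1))%:E < 1%:E)%E].
  apply: (@exists_light_child U r nr 1 (slack 0) (slack 1) (Nt 1%N) (4 * C)^-1) => //.
  - exact: slack01.
  - exact: slack01.
  - by rewrite invr_gt0 mulr_gt0.
  - by move=> M; apply: HNt.
  apply: (@le_lt_trans _ _ (\sum_(0 <= i <oo) ((2 * C)^-1 %:E * (r i `^ s)%:E))%E).
    apply: lee_nneseries => [i _ _|i _].
      rewrite lee_fin mulr_ge0// le_min ler01 /= addr_ge0 ?mulr_ge0 ?powR_ge0//.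
      + by rewrite invr_ge0 ltW// mulr_gt0.
      + exact: ltW.
      + by rewrite invr_ge0 mulr_ge0// ltW.
    rewrite -EFinM lee_fin; have /andP[ri0 rid] := rd i.
    have key : c * r i <= (4 * C)^-1 * r i `^ s.
      have E : r i `^ s * r i `^ (1 - s) = r i.
        rewrite -powRD; last by rewrite (gt_eqF ri0) implybT.
        by rewrite (addrC s) subrK powRr1// ltW.
      rewrite -{1}E mulrCA [leLHS]mulrC [leLHS]mulrC [leRHS]mulrC ler_wpM2l ?powR_ge0//.
      have rd' : r i `^ (1 - s) <= (4 * C * c)^-1.
        apply: (@le_trans _ _ (delta `^ (1 - s))).
          by apply: ge0_ler_powR; rewrite ?nnegrE; [lra|exact: ltW|exact: ltW|].
        rewrite /delta -powRrM mulVf ?powRr1//; last by rewrite gt_eqF//; lra.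
        by rewrite invr_ge0 ltW.
      apply: (@le_trans _ _ (c * (4 * C * c)^-1)); first by rewrite ler_pM2l.
      by rewrite (invfM (4 * C)) mulrCA divff ?gt_eqF// mulr1.
    case: hit; last by rewrite mul0r mulr_ge0 ?powR_ge0// invr_ge0 mulr_ge0// ltW.
    rewrite mul1r ge_min; apply/orP; right.
    have -> : (2 * C)^-1 = (4 * C)^-1 + (4 * C)^-1 by field; rewrite gt_eqF.
    by rewrite [leRHS]mulrDl; apply: lerD.
  rewrite nneseriesZl; last by move=> i _; rewrite lee_fin powR_ge0.
  apply: (@le_lt_trans _ _ ((2 * C)^-1%:E * C%:E)%E).
    by rewrite lee_wpmul2l// lee_fin invr_ge0 mulr_ge0// ltW.
  rewrite -EFinM lte_fin; have -> : (2 * C)^-1 * C = 2^-1 by field; rewrite gt_eqF.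
  by lra.
(* The states of the dependent choice are triples of step, level and numerator; beyond [Nt k] the
   tails are small enough for the slack of step [k]. *)
pose Inv (t : nat * nat * int) := [/\ (Nt t.1.1 <= t.1.2)%N, 0 <= t.2 &
  (\sum_(0 <= i <oo) ((hit (U i) t.1.2 t.2 (slack t.1.1))%:R *
     cost (r i) t.1.2 (slack t.1.1))%:E < 1%:E)%E].
pose rel (t t' : {t | Inv t}) := (sval t').1.1 = (sval t).1.1.+1 /\
  child (sval t).1.2 (sval t).2 (slack (sval t).1.1) (sval t').1.2 (sval t').2.
have next t : {t' | rel t t'}.
  apply: cid; case: t => -[[k n] z] [/= Nk z0 load].
  have fn0 := f0 n; have /andP[ek0 _] := slack01 k.
  have [n' [z' [Nn' z'0 ch' load']]] : exists n' z',
      [/\ (Nt k.+1 <= n')%N, 0 <= z', child n z (slack k) n' z' &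
      (\sum_(0 <= i <oo) ((hit (U i) n' z' (slack k.+1))%:R *
         cost (r i) n' (slack k.+1))%:E < 1%:E)%E].
    apply: (@exists_light_child U r n z (slack k) (slack k.+1) (Nt k.+1)
      (24 * b%:R * (slack k * f n)^-1 `^ s)) => //.
    - exact: slack01.
    - exact: slack01.
    - by rewrite mulr_gt0 ?mulr_gt0// powR_gt0// invr_gt0 mulr_gt0.
    - by move=> M; apply: HNt.
    apply: le_lt_trans load; apply: lee_nneseries => [i _ _|i _]; rewrite lee_fin.
      rewrite mulr_ge0// le_min ler01 /= addr_ge0 ?mulr_ge0 ?powR_ge0//.
      + by rewrite invr_ge0 ltW// mulr_gt0.
      + exact: ltW.
    by rewrite ler_wpM2l// le_cost.
  by exists (exist Inv (k.+1, n', z') (And3 Nn' z'0 load')).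
have [g [g0 gch]] := dependent_choice next (exist Inv (1%N, n1, z1) (And3 N1n1 z10 load1)).
pose n j := (sval (g j)).1.2; pose z j := (sval (g j)).2.
have kj j : (sval (g j)).1.1 = (1 + j)%N.
  by elim: j => [|j IH]; [rewrite g0|have [-> _] := gch j; rewrite IH].
have ch j : child (n j) (z j) (slack (1 + j)) (n j.+1) (z j.+1).
  by have [_] := gch j; rewrite kj.
have [x Jx] := nested_shells_meet (fun j => slack01 (1 + j)) ch.
have n0n : (n0 <= n 0)%N.
  by rewrite /n g0 /=; have [/ltnW + _ _ _] := ch1; apply: leq_trans.
have [xinf xex] := nested_shells_exact n0n ch Jx.
exists x; split=> //.
- have : shell nr 1 (slack 0) x.
    apply: child_sub ch1 _ _; last by have := Jx 0%N; rewrite /n /z g0 => jx; exact: jx.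
    by have /andP[-> ?] := slack01 1; lra.
  move=> /shell_bounds; have := fsmall nr0; have := HN1 _ nr1.
  have : 0 < (B nr)^-1 by rewrite invr_gt0.
  rewrite /bfrac mul1r => ? ? ? /andP[? ?]; apply/andP; split; nra.
move=> i Uix.
(* The single term of [U i] in the load is below 1; were [r i] at least b^-n_j, it would exceed the
   shell length and cost 1. *)
have rl j : r i < (B (n j))^-1.
  have [_ _] := svalP (g j); rewrite -/(n j) -/(z j) kj => load.
  have := le_lt_trans (nneseries_ge_term i _) load.
  rewrite (hit_shell Uix (Jx j)) mul1r => /(_ _); rewrite lte_fin => cost1.
  have {cost1} : cost (r i) (n j) (slack (1 + j)) < 1.
    by apply: cost1 => k; rewrite mulr_ge0// cost_ge0.
  rewrite /cost gt_min ltxx /=.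
  have fnj := f0 (n j); have /andP[ej0 ej1] := slack01 (1 + j).
  have l0 : 0 < slack (1 + j) * f (n j) by rewrite mulr_gt0.
  move=> lt; rewrite ltNge; apply/negP => Br.
  have := fsmall (leq_trans n0n _ : (n0 <= n j)%N).
  have nj : (n 0 <= n j)%N by elim: j {lt load fnj ej0 ej1 l0 Br} => // j IH;
    apply: leq_trans IH (ltnW _); have [] := ch j.
  move=> /(_ nj) fB.
  have a1 : 1 <= r i / (slack (1 + j) * f (n j)) by rewrite ler_pdivlMr// mul1r; nra.
  have : 1 <= (r i / (slack (1 + j) * f (n j))) `^ s.
    by rewrite -(powRr0 (r i / (slack (1 + j) * f (n j)))); apply: ler_powR => //; exact: ltW.
  by move=> ?; nra.
have [N HN] := bpow_inv_small (r0 i).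
have nge j : (j <= n j)%N.
  by elim: j => // j /leq_ltn_trans; apply; have [] := ch j.
by have := rl N; rewrite ltNge HN.
Qed.

End Nested.

(** * From pairs (p, q) to levels, and bounds for the Hausdorff content *)

Section Powers.
Variables (R : realType) (b : nat).
Hypothesis b2 : (2 <= b)%N.

Lemma finite_int_ball (K : R) : finite_set [set p : int | `|p%:~R| <= K].
Proof.
pose k := (Num.truncn K).+1.
apply: (@sub_finite_set _ _ ((Posz @` `I_k) `|` (Negz @` `I_k))); last first.
  by rewrite finite_setU; split; apply: finite_image; exact: finite_II.
move=> p /=; rewrite -intr_norm -natr_absz => pK.
have pk : (`|p| < k)%N.
  rewrite ltnS truncn_ge_nat//; exact: le_trans pK.
case: p pk {pK} => p pk; [left|right]; exists p => //=.
by apply: ltn_trans pk; rewrite ltnS.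
Qed.

(** Each level contributes only finitely many numerators, so infinitely many pairs amount to
    unboundedly many levels. *)
Lemma infinite_powersP (phi : nat -> R) x :
  infinite_set [set pq : int * nat |
    powers b pq.2 /\ `|x - pq.1%:~R / pq.2%:R| < phi pq.2] <->
  forall N, exists m y, (N <= m)%N /\ `|x - bfrac R b m y| < phi (b ^ m)%N.
Proof.
set S := [set pq | _]; split=> [infS N|unb finS].
  apply: contrapT => noN; apply: infS.
  pose K m : R := (`|x| + `|phi (b ^ m)%N|) * (b ^ m)%:R.
  apply: (@sub_finite_set _ _ (\bigcup_(m in `I_N)
      ([set p : int | `|p%:~R| <= K m] `*` [set (b ^ m)%N]))); last first.
    apply: bigcup_finite; first exact: finite_II.
    by move=> m _; apply: finite_setX; [exact: finite_int_ball|exact: finite_set1].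
  move=> [p q] [[m m1 /= qE]] /=; rewrite qE => xp.
  exists m; first by rewrite /= ltnNge; apply/negP => Nm; apply: noN;
    exists m, p; split=> //; rewrite /bfrac -natrX.
  split => //=.
  have bm : 0 < (b ^ m)%:R :> R by rewrite ltr0n expn_gt0 ltnW.
  rewrite /K -ler_pdivrMr// -[X in _ / X]gtr0_norm// -normf_div.
  rewrite -[X in `|X|](subKr x); apply: le_trans (ler_normB _ _) _.
  by rewrite lerD2l; apply: (le_trans (ltW xp)); exact: ler_norm.
move: finS => /finite_seqP[t St].
have [m [y [Nm xy]]] := unb (\max_(pq <- t) pq.2).+1.
(* The level [m] exceeds every denominator in the finite list, hence so does b^m; the successor in
   its choice also makes [m] at least 1. *)
have : S (y, (b ^ m)%N).
  split; last by move: xy; rewrite /bfrac -natrX.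
  by exists m => //; apply: leq_trans Nm.
rewrite St /= => yt; have := @leq_bigmax_seq _ t xpredT snd _ yt isT.
by rewrite leqNgt /= (leq_trans Nm)//; apply/ltnW/ltn_expl.
Qed.

Section Content.
Variables (s : R) (E : set R).
Hypothesis s01 : 0 < s < 1.

Lemma diam_ge0 (U : set R) x : U x -> (0 <= diam U)%E.
Proof.
by move=> Ux; apply: ereal_sup_ubound; exists (x, x) => //=; rewrite subrr normr0.
Qed.

Lemma diam_pow_ge0 (U : set R) : (0 <= diam_pow s U)%E.
Proof. by rewrite /diam_pow; case: ifP => // _; exact: poweR_ge0. Qed.

Lemma hausdorff_content_ge0 delta : (0 <= hausdorff_content s delta E)%E.
Proof.
apply: le_ereal_inf_tmp => _ [U _ <-].
by apply: nneseries_ge0 => i _ _; exact: diam_pow_ge0.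
Qed.

(* The padding by [delta / 2^(i+1)] makes every [r i] positive, so that sets
   of diameter 0 need no separate treatment. *)
Lemma hausdorff_content_ge delta C : 0 < delta -> 0 < C ->
  (forall (U : nat -> set R) (r : nat -> R),
    (forall i, 0 < r i <= delta) ->
    (forall i (x y : R), U i x -> U i y -> `|x - y| <= r i) ->
    (\sum_(0 <= i <oo) (r i `^ s)%:E <= (C + 1)%:E)%E ->
    exists2 x, E x & forall i, ~ U i x) ->
  (C%:E <= hausdorff_content s delta E)%E.
Proof.
move=> d0 C0 avoid; have /andP[s0 s1] := s01.
apply: le_ereal_inf_tmp => _ [U [Ud EU] <-].
rewrite leNgt; apply/negP => UC.
(* The [s]-th powers of the [tau i] sum to at most 1, which accounts for the budget [C + 1]. *)
pose tau i : R := Num.min delta ((1 / (2 ^ i.+1)%:R) `^ s^-1).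
have i2 i : 0 < 1 / (2 ^ i.+1)%:R :> R by rewrite divr_gt0// ltr0n expn_gt0.
have tau0 i : 0 < tau i by rewrite lt_min d0 powR_gt0.
have taus i : tau i `^ s <= 1 / (2 ^ i.+1)%:R.
  have <- : ((1 / (2 ^ i.+1)%:R) `^ s^-1) `^ s = 1 / (2 ^ i.+1)%:R :> R.
    by rewrite -powRrM mulVf ?gt_eqF// powRr1// ltW.
  by apply: ge0_ler_powR; rewrite ?nnegrE ?powR_ge0 ?(ltW s0) ?(ltW (tau0 i))// ge_min lexx orbT.
pose r i : R := Num.max (fine (diam (U i))) (tau i).
have diamE i x : U i x -> diam (U i) = (fine (diam (U i)))%:E.
  move=> Ux; rewrite fineK// ge0_fin_numE ?(diam_ge0 Ux)//.
  exact: le_lt_trans (Ud i) (ltry _).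
have dd i : fine (diam (U i)) <= delta.
  have [/eqP U0|/set0P[x Ux]] := boolP (U i == set0); last first.
    by rewrite -lee_fin -(diamE _ _ Ux).
  (* [fine] sends -oo to 0. *)
  suff -> : diam (U i) = -oo%E by exact: ltW.
  by rewrite U0 /diam setX0 image_set0 ereal_sup0.
have rd i : 0 < r i <= delta.
  by rewrite lt_max tau0 orbT /= ge_max dd ge_min lexx.
have rs i : ((r i `^ s)%:E <= diam_pow s (U i) + (1 / (2 ^ i.+1)%:R)%:E)%E.
  rewrite /r; have [le|lt] := leP (fine (diam (U i))) (tau i).
    by rewrite -[leLHS]add0e leeD ?diam_pow_ge0// lee_fin.
  rewrite -[leLHS]adde0; apply: leeD; last by rewrite lee_fin ltW.
  rewrite /diam_pow; case: ifPn => [/eqP U0|/set0P[x Ux]].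
    have : fine (diam (U i)) = 0.
      by rewrite U0 /diam setX0 image_set0 ereal_sup0.
    by move=> e; have := tau0 i; rewrite ltNge (ltW (lt_le_trans lt _))// e.
  by rewrite (diamE _ _ Ux) poweR_EFin.
have [] := avoid U r rd.
- move=> i x y Ux Uy; rewrite le_max; apply/orP; left.
  rewrite -lee_fin -(diamE _ _ Ux); apply: ereal_sup_ubound.
  by exists (x, y).
- apply: (@le_trans _ _ (\sum_(0 <= i <oo) (diam_pow s (U i) + (1 / (2 ^ i.+1)%:R)%:E))%E).
    by apply: lee_nneseries => [i _ _|i _]; rewrite ?lee_fin ?powR_ge0.
  apply: le_trans (epsilon_trick _ _ _) _ => //; first by move=> i; exact: diam_pow_ge0.
  by rewrite EFinD leeD// ltW.
by move=> x /EU[i _ Uix] /(_ i).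
Qed.

End Content.


(** * The covering bound for convergence *)

Section Cover.
Variables (s : R) (f : nat -> R) (E : set R).
Hypothesis s01 : 0 < s < 1.
Hypothesis f0 : forall n, 0 < f n.

Local Notation B n := (b%:R ^+ n : R).

(* The index [i] in [b^(n+1), b^(n+2)) encodes the ball of level [n] centred
   at [(i - b^(n+1)) / b^n]. *)
Definition ball_cover N (i : nat) : set R :=
  if (i < b ^ N.+1)%N then set0 else
  let n := (trunc_log b i).-1 in
  [set x | `|x - (i - b ^ n.+1)%:R / B n| < f n].

Lemma sum_trunc_log (g : nat -> R) N M : (N <= M)%N ->
  \sum_(b ^ N.+1 <= i < b ^ M.+1) g (trunc_log b i).-1 =
  \sum_(N <= n < M) (b ^ n.+2 - b ^ n.+1)%:R * g n.
Proof.
elim: M => [|M IH]; first by rewrite leqn0 => /eqP ->; rewrite !big_geq.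
rewrite leq_eqVlt => /predU1P[->|]; first by rewrite !big_geq.
rewrite ltnS => NM; rewrite big_nat_recr//= -IH//.
have bM : (b ^ M.+1 <= b ^ M.+2)%N by rewrite leq_exp2l.
rewrite (@big_cat_nat _ _ _ (b ^ M.+1)%N)//=; last by rewrite leq_exp2l.
congr (_ + _); rewrite big_nat (eq_bigr (fun=> g M)).
  by rewrite -big_nat sumr_const_nat mulr_natl.
by move=> i bi; rewrite (trunc_log_eq b2 bi).
Qed.

Lemma diam_pow_ball_le N i :
  (diam_pow s (ball_cover N i) <=
   (if (i < b ^ N.+1)%N then 0 else (2 * f (trunc_log b i).-1) `^ s)%:E)%E.
Proof.
have /andP[s0 _] := s01.
rewrite /diam_pow; case: ifPn => [_|/set0P[x Ux]].
  by case: ifP => _; rewrite lee_fin// powR_ge0.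
have := Ux; rewrite {1}/ball_cover; case: ifPn => // iN _.
rewrite -poweR_EFin; apply: gt0_ler_poweR; first exact: ltW.
- by rewrite in_itv /= leey andbT; exact: diam_ge0 Ux.
- by rewrite in_itv /= leey andbT lee_fin mulr_ge0// ltW.
apply: ge_ereal_sup => _ [[u v] [/= uU vU] <-]; rewrite lee_fin.
move: uU vU; rewrite /ball_cover (negbTE iN) /= !ltr_norml => /andP[u1 u2] /andP[v1 v2].
by rewrite ler_norml; apply/andP; split; lra.
Qed.

Hypothesis fle : forall m n, (m <= n)%N -> f n <= f m.

(** The balls of level at least [N] form the cover. The factor 2^s comes from diameters 2 f(n), and
    b^2 from reserving up to b^(n+2) indices for level [n]. *)
Lemma hausdorff_content_le_tail delta N eta : 2 * f N <= delta -> 0 < delta ->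
  (forall x, E x -> exists m (p : nat),
    [/\ (N <= m)%N, (p <= b ^ m)%N & `|x - p%:R / B m| < f m]) ->
  (forall M, \sum_(N <= n < M) B n * f n `^ s <= eta) ->
  (hausdorff_content s delta E <= (b%:R ^+ 2 * 2 `^ s * eta)%:E)%E.
Proof.
move=> fd d0 EN tail; have /andP[s0 _] := s01.
apply: (@le_trans _ _ (\sum_(0 <= i <oo) diam_pow s (ball_cover N i))%E).
  apply: ereal_inf_lbound; exists (ball_cover N) => //; split.
    move=> i; have [/eqP ->|/set0P[x Ux]] := boolP (ball_cover N i == set0).
      by rewrite /diam setX0 image_set0 ereal_sup0 leNye.
    have := Ux; rewrite {1}/ball_cover; case: ifPn => // iN _.
    have Nn : (N <= (trunc_log b i).-1)%N.
      rewrite -[N]/(N.+1.-1) -!subn1 leq_sub2r// trunc_log_max//.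
      by rewrite leqNgt.
    apply: ge_ereal_sup => _ [[u v] [/= uU vU] <-]; rewrite lee_fin.
    move: uU vU; rewrite /ball_cover (negbTE iN) /= !ltr_norml => /andP[u1 u2] /andP[v1 v2].
    by have := fle Nn => ?; rewrite ler_norml; apply/andP; split; lra.
  (* The index stays in the block of level [m] because p <= b^m < b^(m+1) and 2 b^(m+1) <=
     b^(m+2). *)
  move=> x /EN[m [p [Nm pm xp]]]; exists (p + b ^ m.+1)%N => //.
  have bm : (b ^ m < b ^ m.+1)%N by rewrite ltn_exp2l.
  have tl : trunc_log b (p + b ^ m.+1) = m.+1.
    apply: trunc_log_eq => //; rewrite leq_addl /= [(b ^ m.+2)%N]expnS.
    apply: (@leq_trans (2 * b ^ m.+1)); last by rewrite leq_mul2r b2 orbT.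
    by rewrite mul2n -addnn ltn_add2r (leq_ltn_trans pm).
  rewrite /ball_cover tl /= addnK ltnNge.
  by rewrite (leq_trans _ (leq_addl _ _))// leq_exp2l.
pose u i : R := if (i < b ^ N.+1)%N then 0 else (2 * f (trunc_log b i).-1) `^ s.
have u0 i : 0 <= u i by rewrite /u; case: ifP => // _; rewrite powR_ge0.
apply: (@le_trans _ _ (\sum_(0 <= i <oo) (u i)%:E)%E).
  apply: lee_nneseries => [i _ _|i _]; [exact: diam_pow_ge0|exact: diam_pow_ball_le].
apply: lime_le; first by apply: is_cvg_nneseries => i _ _; rewrite lee_fin.
apply: nearW => K; rewrite sumEFin lee_fin.
pose M := maxn N K.
have KM : (K <= b ^ M.+1)%N.
  apply: (@leq_trans M); first by rewrite leq_maxr.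
  by apply: ltnW; apply: leq_trans (ltn_expl _ b2) _; rewrite leq_exp2l.
apply: (@le_trans _ _ (\sum_(0 <= i < b ^ M.+1) u i)).
  by rewrite [leRHS](@big_cat_nat _ _ _ K)//= lerDl sumr_ge0.
have NM : (N <= M)%N by rewrite leq_maxl.
rewrite (@big_cat_nat _ _ _ (b ^ N.+1)%N)//=; last by rewrite leq_exp2l.
rewrite big_nat big1 ?add0r; last by move=> i /andP[_ iN]; rewrite /u iN.
have -> : \sum_(b ^ N.+1 <= i < b ^ M.+1) u i =
    \sum_(b ^ N.+1 <= i < b ^ M.+1) (2 * f (trunc_log b i).-1) `^ s.
  by apply: eq_big_nat => i /andP[iN _]; rewrite /u ltnNge iN.
rewrite (sum_trunc_log (fun n => (2 * f n) `^ s) NM).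
apply: (@le_trans _ _ (b%:R ^+ 2 * 2 `^ s * \sum_(N <= n < M) B n * f n `^ s)).
  rewrite mulr_sumr; apply: ler_sum => n _.
  rewrite powRM// ?(ltW (f0 n))//.
  have -> : b%:R ^+ 2 * 2 `^ s * (B n * f n `^ s) =
    B n.+2 * (2 `^ s * f n `^ s) by rewrite !exprS expr0; ring.
  rewrite ler_wpM2r ?mulr_ge0 ?powR_ge0// -natrX ler_nat leq_subr//.
by rewrite ler_wpM2l// mulr_ge0 ?powR_ge0// exprn_ge0.
Qed.

End Cover.

End Powers.

(** * Tails of convergent and divergent series *)

Section Series.
Variable R : realType.
Implicit Type a : nat -> R.

Lemma nneseries_tail_small a : (forall n, 0 <= a n) ->
  (\sum_(1 <= n <oo) (a n)%:E < +oo)%E -> forall eta, 0 < eta ->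
  exists N, forall n M, (N <= n)%N -> \sum_(n <= m < M) a m <= eta.
Proof.
move=> a0 afin eta eta0.
have afin0 : (\sum_(0 <= n <oo) (a n)%:E < +oo)%E.
  rewrite (nneseries_split 0 1); last by move=> k _; rewrite lee_fin.
  by rewrite add0n big_nat1 lte_add_pinfty// ltry.
have := nneseries_tail_cvg afin0 (fun k _ => a0 k : (0 <= (a k)%:E)%E).
move=> /fine_cvgP[_ /cvgrPdist_le /(_ _ eta0)[N _ HN]].
have fin n : (\sum_(n <= m <oo) (a m)%:E)%E \is a fin_num.
  rewrite ge0_fin_numE; last by apply: nneseries_ge0 => i _ _; rewrite lee_fin.
  apply: le_lt_trans afin0; rewrite [leRHS](nneseries_split 0 n); last first.
    by move=> k _; rewrite lee_fin.
  by rewrite add0n leeDr// sume_ge0// => i _; rewrite lee_fin.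
exists N => n M Nn; have := HN n Nn; rewrite /= sub0r normrN => le.
rewrite -lee_fin -sumEFin.
apply: (@le_trans _ _ (\sum_(n <= m <oo) (a m)%:E)%E).
  by apply: nneseries_lim_ge => i _ _; rewrite lee_fin.
by rewrite -(fineK (fin n)) lee_fin; apply: le_trans (ler_norm _) le.
Qed.

(** If all sums from [N] stayed below [C], the whole series would be bounded by its first [N] terms
    plus [C]. *)
Lemma nneseries_tail_large a : (forall n, 0 <= a n) ->
  (\sum_(1 <= n <oo) (a n)%:E = +oo)%E -> forall N C,
  exists M, C <= \sum_(N <= m < M) a m.
Proof.
move=> a0 ainf N C; apply: contrapT => small.
have {}small M : \sum_(N <= m < M) a m < C.
  by rewrite ltNge; apply/negP => H; apply: small; exists M.
suff : (\sum_(1 <= n <oo) (a n)%:E <= (\sum_(0 <= m < N) a m + C)%:E)%E.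
  by rewrite ainf leye_eq.
apply: lime_le; first by apply: is_cvg_nneseries => i _ _; rewrite lee_fin.
apply: nearW => k; rewrite sumEFin lee_fin.
apply: (@le_trans _ _ (\sum_(0 <= m < N + k) a m)).
  case: k => [|k]; first by rewrite big_geq// sumr_ge0.
  apply: (@le_trans _ _ (\sum_(0 <= m < k.+1) a m)).
    by rewrite [leRHS]big_ltn// lerDr.
  by rewrite [leRHS](@big_cat_nat _ _ _ k.+1)//= ?leq_addl// lerDl sumr_ge0.
rewrite (@big_cat_nat _ _ _ N)//= ?leq_addr// lerD2l; exact: ltW.
Qed.

End Series.

(** * The zero-infinity dichotomy for the exact set *)

Theorem theorem3p5 (R : realType) (b : nat) (b_ge2 : (2 <= b)%N)
  (psi : nat -> R)
  (psi_gt0 : forall q : nat, (1 <= q)%N -> 0 < psi q)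
  (psi_noninc : forall q r : nat, (1 <= q)%N -> (q <= r)%N -> psi r <= psi q)
  (psi_sum : (\sum_(1 <= n <oo) (b%:R ^+ (2 * n) * psi (b ^ n)%N)%:E
              < +oo :> \bar R)%E)
  (s : R) (s01 : 0 < s < 1) :
  ((\sum_(1 <= n <oo) (b%:R ^+ n * (psi (b ^ n)%N `^ s))%:E
      < +oo :> \bar R)%E ->
    hausdorff_measure s (exact_set (powers b) psi) = 0%E)
  /\
  ((\sum_(1 <= n <oo) (b%:R ^+ n * (psi (b ^ n)%N `^ s))%:E
      = +oo :> \bar R)%E ->
    hausdorff_measure s (exact_set (powers b) psi) = +oo%E).
Proof.
pose f n := psi (b ^ n)%N.
have bn1 n : (1 <= b ^ n)%N by rewrite expn_gt0 ltnW.
have f0 n : 0 < f n by exact: psi_gt0.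
have fle m n : (m <= n)%N -> f n <= f m.
  by move=> mn; apply: psi_noninc => //; rewrite leq_exp2l.
have b1 : 1 <= b%:R :> R by rewrite ler1n ltnW.
have B1 n : 1 <= b%:R ^+ n :> R by exact: exprn_ege1.
have B0 n : 0 < b%:R ^+ n :> R by exact: lt_le_trans ltr01 (B1 n).
have Bf0 n : 0 <= b%:R ^+ (2 * n) * f n by rewrite mulr_ge0// ltW.
have Bfs0 n : 0 <= b%:R ^+ n * f n `^ s by rewrite mulr_ge0 ?powR_ge0// ltW.
have tail2 := nneseries_tail_small Bf0 psi_sum.
have BB n : b%:R ^+ n <= b%:R ^+ (2 * n) :> R.
  by apply: ler_weXn2l => //; rewrite leq_pmull.
have [n0 fsmall] : exists n0, forall n, (n0 <= n)%N -> f n <= (b%:R ^+ n)^-1 / 8.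
  have i8 : 0 < 8^-1 :> R by rewrite invr_gt0.
  (* A one-term tail gives b^(2n) f(n) <= 1/8 eventually, and b^n <= b^(2n). *)
  have [n0 H] := tail2 _ i8.
  exists n0 => n nn0; have := H n n.+1 nn0; rewrite big_nat1 => le.
  rewrite mulrC -[leRHS]mulrC ler_pdivlMl//; apply: le_trans le.
  by rewrite ler_wpM2r// ltW.
split=> [fin|inf].
  apply/eqP; rewrite eq_le; apply/andP; split; last first.
    apply: (@le_trans _ _ (hausdorff_content s 1 (exact_set (powers b) psi))).
      exact: hausdorff_content_ge0.
    by apply: ereal_sup_ubound; exists 1 => /=.
  apply: ge_ereal_sup => _ [delta /= d0 <-].
  apply/lee_addgt0Pr => eta eta0; rewrite add0e.
  pose c : R := b%:R ^+ 2 * 2 `^ s.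
  have c0 : 0 < c by rewrite mulr_gt0// powR_gt0.
  have [N1 HN1] := nneseries_tail_small Bfs0 fin (divr_gt0 eta0 c0).
  have [N2 HN2] := tail2 (delta / 2) (divr_gt0 d0 (ltr0Sn _ 1)).
  pose N := maxn n0 (maxn N1 N2).
  have [Nn0 NN1 NN2] : [/\ (n0 <= N)%N, (N1 <= N)%N & (N2 <= N)%N].
    by rewrite /N !leq_max !leqnn !orbT.
  have -> : eta = c * (eta / c) by rewrite mulrCA divff ?mulr1// gt_eqF.
  apply: (@hausdorff_content_le_tail _ _ b_ge2 s f _ s01 f0 fle delta N) => //.
  - have := HN2 N N.+1 NN2; rewrite big_nat1 => le.
    rewrite -ler_pdivlMl// mulrC; apply: le_trans le.
    by rewrite ler_peMl// ltW.
  - move=> x [[/andP[x0 x1] /(infinite_powersP b_ge2)/(_ N)[m [y [Nm xy]]]] _].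
    have := fsmall m (leq_trans Nn0 Nm) => fm.
    have Bi : 0 < (b%:R ^+ m)^-1 :> R by rewrite invr_gt0.
    move: xy; rewrite -/(f m) ltr_norml => /andP[xy1 xy2].
    (* As [f m] is below the spacing b^-m, a fraction that close to a point of [0,1] has its
       numerator between 0 and b^m, as the cover requires. *)
    have ylo : (-1 < y)%R.
      rewrite -(ltr_int R); have : - (b%:R ^+ m)^-1 < bfrac R b m y by lra.
      by rewrite /bfrac ltr_pdivlMr// mulNr mulVf ?gt_eqF// rmorphN1.
    have yhi : (y < (b ^ m).+1%:Z)%R.
      rewrite -(ltr_int R) -pmulrn -[_.+1]addn1 natrD natrX.
      have : bfrac R b m y < (b%:R ^+ m + 1) / b%:R ^+ m.
        by rewrite mulrDl divff ?gt_eqF// mul1r; lra.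
      by rewrite /bfrac ltr_pM2r.
    case: y ylo yhi xy1 xy2 => // p _ pm xy1 xy2; exists m, p; split=> //.
    by rewrite ltr_norml; apply/andP; rewrite /bfrac -pmulrn in xy1 xy2.
  - by move=> M; exact: HN1.
have tails eta : 0 < eta -> exists N, forall n M, (N <= n)%N ->
    \sum_(n <= m < M) b%:R ^+ m * f m <= eta.
  move=> /tail2[N HN]; exists N => n M Nn; apply: le_trans (HN n M Nn).
  by apply: ler_sum => m _; rewrite ler_wpM2r// ltW.
have div := nneseries_tail_large Bfs0 inf.
have large C : 0 < C ->
    (C%:E <= hausdorff_measure s (exact_set (powers b) psi))%E.
  move=> C0; have C1 : 0 < C + 1 by rewrite addr_gt0.
  have [delta d0 avoid] := exact_point_avoiding b_ge2 f0 fle s01 fsmall div tails C1.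
  apply: (@le_trans _ _ (hausdorff_content s delta (exact_set (powers b) psi))).
    apply: (hausdorff_content_ge s01 d0 C0) => U r rd Ur rC.
    have [x [x01 xinf xex xU]] := avoid U r rd Ur rC.
    exists x => //; split; first by split=> //; exact/infinite_powersP.
    move=> [t /= t01 [_ /(infinite_powersP b_ge2 (fun q => t * psi q)) xt]].
    have [N HN] := xex t t01; have [m [y [Nm]]] := xt N.
    by rewrite ltNge (HN _ _ Nm).
  by apply: ereal_sup_ubound; exists delta.
apply: eq_infty => C; apply: (@le_trans _ _ (Num.max C 1)%:E).
  by rewrite lee_fin le_max lexx.
by apply: large; rewrite lt_max ltr01 orbT.
Qed.
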